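(* Let $\psi^{(ee)}\in L^2(\mathbb{R}^2)$ be a real-valued admissible wavelet with $\psi^{(ee)}(x_1,x_2)=\psi^{(ee)}(\pm x_1,\pm x_2)=\psi^{(ee)}(x_2,x_1)$, and let $\psi^{++}$ be the hypercomplexing mother wavelet built from it. Then $\psi^{++}$ is not a hypercomplex signal, i.e. there is no real-valued $g\in L^2(\mathbb{R}^2)$ such that $\psi^{++}=g^{(++)}$.
   Context: $\mathbb{H}$ is the skew field of quaternions with units $\mathbf{i},\mathbf{j},\mathbf{k}$, $\mathbf{i}^2=\mathbf{j}^2=\mathbf{k}^2=\mathbf{i}\mathbf{j}\mathbf{k}=-1$. For $l=1,2$, $\mathcal{H}_l$ is the partial Hilbert transform in the variable $x_l$, i.e. the Fourier multiplier $-\mathbf{j}\,\mathrm{sgn}(f_l)$ for the Fourier transform $G(\mathbf{f})=\int_{\mathbb{R}^2}g(\mathbf{x})e^{-2\pi\mathbf{j}\mathbf{f}^T\mathbf{x}}\,d^2\mathbf{x}$ (it maps real functions to real functions), and $\mathcal{H}_T=\mathcal{H}_2\mathcal{H}_1$. Hypercomplex signal of a real-valued $g\in L^2(\mathbb{R}^2)$: $g^{(++)}=g+\mathbf{i}\,\mathcal{H}_1g+\mathbf{j}\,\mathcal{H}_2g+\mathbf{k}\,\mathcal{H}_Tg$. A real $\psi\in L^2(\mathbb{R}^2)$ is admissible if $\int|\psi|^2=1$ and $0<(2\pi)^2\int_{\mathbb{R}^2}|\Psi(\mathbf{f})|^2/|\mathbf{f}|^2\,d^2\mathbf{f}<\infty$,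 with $\Psi$ the Fourier transform of $\psi$. Hypercomplexing mother wavelet: $\psi^{++}=\psi^{(ee)}+\mathbf{i}\,\psi^{(oe)}+\mathbf{j}\,\psi^{(eo)}-\mathbf{k}\,\psi^{(oo)}$, where $\psi^{(oe)}=\mathcal{H}_1\psi^{(ee)}$, $\psi^{(eo)}=\mathcal{H}_2\psi^{(ee)}$, $\psi^{(oo)}=\mathcal{H}_2\mathcal{H}_1\psi^{(ee)}$. *)

(* Defs.v *)
From HB Require Import structures.
From mathcomp Require Import all_boot all_order all_algebra.
From mathcomp Require Import ring.
From mathcomp Require Import all_classical all_reals all_analysis.

Set Implicit Arguments.
Unset Strict Implicit.
Unset Printing Implicit Defensive.

Import Order.TTheory GRing.Theory Num.Theory.
Import numFieldNormedType.Exports.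

Local Open Scope classical_set_scope.
Local Open Scope ring_scope.

Record quat (R : Type) : Type :=
  Quat { q_re : R ; q_i : R ; q_j : R ; q_k : R }.
Arguments Quat {R}.
Arguments q_re {R}.
Arguments q_i {R}.
Arguments q_j {R}.
Arguments q_k {R}.

Definition quat_to_tuple (R : Type) (q : quat R) : R * R * R * R :=
  (q_re q, q_i q, q_j q, q_k q).
Definition quat_of_tuple (R : Type) (t : R * R * R * R) : quat R :=
  let: (a, b, c, d) := t in Quat a b c d.
Lemma quat_to_tupleK (R : Type) :
  cancel (@quat_to_tuple R) (@quat_of_tuple R).
Proof. by case. Qed.

HB.instance Definition _ (R : choiceType) :=
  Choice.copy (quat R) (can_type (@quat_to_tupleK R)).

Section QuatRing.
Context {R : realFieldType}.
Implicit Types p q r : quat R.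

Definition quat0 : quat R := Quat 0 0 0 0.
Definition quat1 : quat R := Quat 1 0 0 0.
Definition quat_opp q := Quat (- q_re q) (- q_i q) (- q_j q) (- q_k q).
Definition quat_add p q :=
  Quat (q_re p + q_re q) (q_i p + q_i q) (q_j p + q_j q) (q_k p + q_k q).
Definition quat_mul p q :=
  Quat (q_re p * q_re q - q_i p * q_i q - q_j p * q_j q - q_k p * q_k q)
       (q_re p * q_i q + q_i p * q_re q + q_j p * q_k q - q_k p * q_j q)
       (q_re p * q_j q - q_i p * q_k q + q_j p * q_re q + q_k p * q_i q)
       (q_re p * q_k q + q_i p * q_j q - q_j p * q_i q + q_k p * q_re q).

Lemma quat_addA : associative quat_add.
Proof. by move=> [????] [????] [????]; rewrite /quat_add /= !addrA. Qed.
Lemma quat_addC : commutative quat_add.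
Proof. by move=> [????] [????]; congr Quat; rewrite /= addrC. Qed.
Lemma quat_add0 : left_id quat0 quat_add.
Proof. by move=> [????]; rewrite /quat_add /= !add0r. Qed.
Lemma quat_addN : left_inverse quat0 quat_opp quat_add.
Proof. by move=> [????]; rewrite /quat_add /= !addNr. Qed.

HB.instance Definition _ :=
  GRing.isZmodule.Build (quat R) quat_addA quat_addC quat_add0 quat_addN.

Lemma quat_mulA : associative quat_mul.
Proof. by move=> [????] [????] [????]; congr Quat; rewrite /=; ring. Qed.
Lemma quat_mul1l : left_id quat1 quat_mul.
Proof. by move=> [????]; rewrite /quat_mul /=; congr Quat; ring. Qed.
Lemma quat_mul1r : right_id quat1 quat_mul.
Proof. by move=> [????]; rewrite /quat_mul /=; congr Quat; ring. Qed.
Lemma quat_mulDl : left_distributive quat_mul +%R.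
Proof. by move=> [????] [????] [????]; congr Quat; rewrite /=; ring. Qed.
Lemma quat_mulDr : right_distributive quat_mul +%R.
Proof. by move=> [????] [????] [????]; congr Quat; rewrite /=; ring. Qed.
Lemma quat_oner_neq0 : quat1 != 0.
Proof. by apply/eqP => -[] /eqP; rewrite oner_eq0. Qed.

HB.instance Definition _ := GRing.Zmodule_isNzRing.Build (quat R)
  quat_mulA quat_mul1l quat_mul1r quat_mulDl quat_mulDr quat_oner_neq0.

Definition qreal (a : R) : quat R := Quat a 0 0 0.
Definition qi : quat R := Quat 0 1 0 0.
Definition qj : quat R := Quat 0 0 1 0.
Definition qk : quat R := Quat 0 0 0 1.

Definition qsqnorm q : R := q_re q ^+ 2 + q_i q ^+ 2 + q_j q ^+ 2 + q_k q ^+ 2.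

Lemma qunitE :
  [/\ qi * qi = -1, qj * qj = -1, qk * qk = -1 & qi * qj * qk = -1].
Proof. by split; congr Quat; rewrite /=; ring. Qed.

Definition quat_inv q : quat R :=
  let n := qsqnorm q in Quat (q_re q / n) (- q_i q / n) (- q_j q / n) (- q_k q / n).

Lemma qsqnorm_eq0 q : (qsqnorm q == 0) = (q == 0).
Proof.
case: q => a b c d; rewrite /qsqnorm /=.
rewrite !paddr_eq0 ?addr_ge0 ?sqr_ge0// !sqrf_eq0.
apply/idP/eqP => [/andP[/andP[/andP[/eqP-> /eqP->] /eqP->] /eqP->]//|].
by case=> -> -> -> ->; rewrite eqxx.
Qed.

Definition quat_unit : {pred quat R} := fun q => q != 0.

Lemma quat_mulVq : {in quat_unit, left_inverse 1 quat_inv *%R}.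
Proof.
move=> q; rewrite unfold_in /quat_unit -qsqnorm_eq0.
by case: q => a b c d; rewrite /qsqnorm/= => q0; congr Quat; rewrite /= /qsqnorm /=; field.
Qed.

Lemma quat_mulqV : {in quat_unit, right_inverse 1 quat_inv *%R}.
Proof.
move=> q; rewrite unfold_in /quat_unit -qsqnorm_eq0.
by case: q => a b c d; rewrite /qsqnorm/= => q0; congr Quat; rewrite /= /qsqnorm /=; field.
Qed.

Lemma quat_unitP p q : q * p = 1 /\ p * q = 1 -> quat_unit p.
Proof.
case=> _ pq; rewrite /quat_unit; apply: contra_eq_neq pq => ->.
by rewrite mul0r eq_sym oner_neq0.
Qed.

Lemma quat_inv_out : {in [predC quat_unit], quat_inv =1 id}.
Proof.
move=> q; rewrite inE /= unfold_in /quat_unit negbK => /eqP ->.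
by rewrite /quat_inv /=; congr Quat; rewrite ?oppr0 mul0r.
Qed.

HB.instance Definition _ := GRing.NzRing_hasMulInverse.Build (quat R)
  quat_mulVq quat_mulqV quat_unitP quat_inv_out.

End QuatRing.

Notation plane R := (measurableTypeR R * measurableTypeR R)%type.

Section Plane.
Context {R : realType}.
Implicit Types (x f : plane R) (g h : plane R -> R) (G : plane R -> quat R).

Definition leb2 : {measure set (plane R) -> \bar R} :=
  ((@lebesgue_measure R) \x (@lebesgue_measure R))%E.

(* Elements of L^2 are represented by functions; identities between them are
   stated almost everywhere. *)
Definition L2 : {pred plane R -> R} := Lfun leb2 2%:E.

Definition L2_quat G : Prop :=
  [/\ q_re \o G \in L2, q_i \o G \in L2, q_j \o G \in L2 & q_k \o G \in L2].

Definition qintegral (D : set (plane R)) G : quat R :=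
  Quat (\int[leb2]_(x in D) q_re (G x)) (\int[leb2]_(x in D) q_i (G x))
       (\int[leb2]_(x in D) q_j (G x)) (\int[leb2]_(x in D) q_k (G x)).

Definition qexpj (t : R) : quat R := qreal (cos t) + qj * qreal (sin t).

Definition dot f x : R := f.1 * x.1 + f.2 * x.2.

Definition box (n : nat) : set (plane R) :=
  `[- n%:R, n%:R]%classic `*` `[- n%:R, n%:R]%classic.

(* The imaginary unit of the Fourier transform is the quaternion unit j. *)
Definition fourier_box (n : nat) g f : quat R :=
  qintegral (box n) (fun x => qreal (g x) * qexpj (- (2 * pi * dot f x))).

(* A function in L^2 need not be integrable: its Fourier transform is the
   limit in L^2 of the Fourier integrals over increasing boxes; it is
   determined up to a null set. *)
Definition is_fourier g G : Prop :=
  L2_quat G /\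
  (fun n => \int[leb2]_f (qsqnorm (G f - fourier_box n g f))%:E)%E @ \oo
    --> 0%E.

(* [pr] is the coordinate, [fst] or [snd], in which the transform is taken.
   Values of the Fourier transform of a real function lie in the plane spanned
   by 1 and j, so they commute with the multiplier. *)
Definition is_hilbert (pr : plane R -> R) g h : Prop :=
  h \in L2 /\
  exists2 G, is_fourier g G &
    is_fourier h (fun f => - qj * qreal (Num.sg (pr f)) * G f).

Definition is_hilbert1 := is_hilbert fst.
Definition is_hilbert2 := is_hilbert snd.

Definition is_hilbertT g h : Prop :=
  exists2 h1, is_hilbert1 g h1 & is_hilbert2 h1 h.

Definition hypercomplex_signal_of g (F : plane R -> quat R) : Prop :=
  exists h1 h2 hT : plane R -> R,
    [/\ is_hilbert1 g h1, is_hilbert2 g h2, is_hilbertT g hT &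
        {ae leb2, forall x, F x = qreal (g x) + qi * qreal (h1 x)
                                  + qj * qreal (h2 x) + qk * qreal (hT x)}].

Definition is_hypercomplex_signal (F : plane R -> quat R) : Prop :=
  exists2 g, g \in L2 & hypercomplex_signal_of g F.

Definition admissible (psi : plane R -> R) : Prop :=
  (\int[leb2]_x (`|psi x| ^+ 2)%:E = 1)%E /\
  exists2 Psi, is_fourier psi Psi &
    (0 < ((2 * pi) ^+ 2)%:E *
         \int[leb2]_f (qsqnorm (Psi f) / (f.1 ^+ 2 + f.2 ^+ 2))%:E < +oo)%E.

(* The k-component carries a minus sign, unlike in a hypercomplex signal. *)
Definition hypercomplexing_wavelet (psi_ee : plane R -> R)
    (psi_pp : plane R -> quat R) : Prop :=
  exists psi_oe psi_eo psi_oo : plane R -> R,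
    [/\ is_hilbert1 psi_ee psi_oe, is_hilbert2 psi_ee psi_eo,
        is_hilbertT psi_ee psi_oo &
        {ae leb2, forall x,
           psi_pp x = qreal (psi_ee x) + qi * qreal (psi_oe x)
                      + qj * qreal (psi_eo x) - qk * qreal (psi_oo x)}].

End Plane.

(* Main.v *)
From HB Require Import structures.
Require Import Defs.
From mathcomp Require Import all_boot all_order all_algebra.
From mathcomp Require Import ring lra.
From mathcomp Require Import all_classical all_reals all_analysis.
From mathcomp Require Import measurable_realfun.

(** Comparing the real and k-components of the two quaternion expansions, an
    identity [psi_pp = g^(++)] forces [g = psi_ee] almost everywhere, and then
    that the total Hilbert transform of [psi_ee] is almost everywhere equal to
    its own opposite, because of the minus sign in front of [k] in the
    hypercomplexing wavelet.  On the Fourier side the total Hilbert transform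
    is multiplication by [- sgn f1 * sgn f2] ([is_hilbertT_fourier]), which
    vanishes only on the two coordinate axes, a null set ([ae_coord_neq0]).
    Hence the Fourier transform of [psi_ee] vanishes almost everywhere
    ([is_hilbertT_opp_fourier_eq0]), and so does the integrand in the
    admissibility condition, whose integral was required to be positive
    ([admissible_fourier_neq0]).

    Fourier transforms being only relations, the argument relies on their
    uniqueness up to null sets ([is_fourier_unique]).  This is the uniqueness
    of limits in L^2, for which the truncated transforms must be measurable in
    the frequency; Tonelli's theorem provides that
    ([measurable_fun_Rintegral]).  Neither Plancherel's theorem nor Fourier
    inversion is needed. *)

Set Implicit Arguments.
Unset Strict Implicit.
Unset Printing Implicit Defensive.

Import Order.TTheory GRing.Theory Num.Theory.
Import numFieldNormedType.Exports.
Local Open Scope classical_set_scope.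
Local Open Scope ring_scope.

(** * Quaternion algebra *)

Section Quaternions.
Context {R : realFieldType}.
Implicit Types p q : quat R.

Lemma qsqnorm_ge0 q : 0 <= qsqnorm q.
Proof. by rewrite /qsqnorm !addr_ge0// sqr_ge0. Qed.

(** Squared triangle inequality through an intermediate point [r]. *)
Lemma qsqnormB_le p q r :
  qsqnorm (p - q) <= 2 * qsqnorm (p - r) + 2 * qsqnorm (q - r).
Proof.
have sq (a b c : R) : (a - b) ^+ 2 <= 2 * (a - c) ^+ 2 + 2 * (b - c) ^+ 2.
  rewrite -subr_ge0 (_ : _ - _ = (a + b - 2 * c) ^+ 2) ?sqr_ge0//; ring.
case: p q r => [a b c d] [a' b' c' d'] [a'' b'' c'' d''].
rewrite /qsqnorm /= !mulrDr.
have := sq a a' a''; have := sq b b' b''.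
have := sq c c' c''; have := sq d d' d''.
move: (_ ^+ 2) => *; lra.
Qed.

Lemma qsqnormN q : qsqnorm (- q) = qsqnorm q.
Proof. by rewrite /qsqnorm /= !sqrrN. Qed.

(** Two successive multipliers [- qj * s] and [- qj * t] amount to the real
    multiplier [- (t * s)]. *)
Lemma qj_multiplier2 (s t : R) q :
  - qj * qreal t * (- qj * qreal s * q) = qreal (- (t * s)) * q.
Proof. by case: q => a b c d; congr Quat => /=; ring. Qed.

Lemma qreal_eqN_eq0 (s : R) q : s != 0 ->
  qreal s * q = - (qreal s * q) -> q = 0.
Proof.
move=> s0 sqN; have /eqP : qsqnorm (qreal s * q) = 0.
  (* [x = - x] gives [2 * x = 0], and the squared norm of [2 * x] is four
     times that of [x]. *)
  have : qsqnorm (qreal s * q + qreal s * q) = 0.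
    by rewrite {2}sqN subrr /qsqnorm /= expr0n/= !addr0.
  case: q {sqN} => a b c d; rewrite /qsqnorm /=; lra.
rewrite qsqnorm_eq0 => /eqP sq0.
have s1 : qreal s^-1 * qreal s = 1 :> quat R.
  by congr Quat => /=; rewrite ?(mulr0, mul0r, subr0, addr0)// mulVf.
by rewrite -[LHS]mul1r -s1 -mulrA sq0 mulr0.
Qed.

End Quaternions.

(** * Measurability of parametrized integrals *)

Section ParametrizedIntegral.
Context d1 d2 (T1 : measurableType d1) (T2 : measurableType d2) (R : realType).
Variable mu : {sigma_finite_measure set T2 -> \bar R}.

(** No integrability is required: the positive and negative parts are handled
    by Tonelli's theorem, and [fine] of their difference is measurable even
    where it is infinite. *)
Lemma measurable_fun_Rintegral (D : set T2) (phi : T1 * T2 -> R) :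
  measurable D -> measurable_fun setT phi ->
  measurable_fun setT (fun x => \int[mu]_(y in D) phi (x, y)).
Proof.
move=> mD mphi.
pose F (z : T1 * T2) : \bar R := (phi z * \1_D z.2)%:E.
have mF : measurable_fun [set: T1 * T2] F.
  apply/measurable_EFinP; apply: measurable_funM => //.
  by apply: measurableT_comp => //; exact: measurable_indic.
rewrite (_ : (fun x => _) =
    fine \o (fubini_F mu F^\+ \- fubini_F mu F^\-)%E); last first.
  apply/funext => x; rewrite /Rintegral /= /fubini_F [in LHS]integral_mkcond [in LHS]integralE.
  congr (fine (_ - _)%E); apply: eq_integral => y _.
    rewrite !funeposE /F patchE indicE/=.
    by case: ifPn => _; rewrite ?mulr1// mulr0.
  rewrite !funenegE /F patchE indicE/=.
  by case: ifPn => _; rewrite ?mulr1// mulr0.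
apply: measurableT_comp; first exact: fine_measurable.
apply: emeasurable_funB; apply: measurable_fun_fubini_tonelli_F.
- exact: measurable_funepos.
- by move=> z; exact: funepos_ge0.
- exact: measurable_funeneg.
- by move=> z; exact: funeneg_ge0.
Qed.

End ParametrizedIntegral.

(** * Limits in L^2 of quaternion-valued functions *)

Section QuaternionValued.
Context d (T : measurableType d) (R : realType).
Variable mu : {measure set T -> \bar R}.
Implicit Types G H : T -> quat R.

(** Measurability of a quaternion-valued function, componentwise. *)
Definition qmeasurable G : Prop :=
  [/\ measurable_fun setT (q_re \o G), measurable_fun setT (q_i \o G),
      measurable_fun setT (q_j \o G) & measurable_fun setT (q_k \o G)].

Lemma qmeasurableB G H : qmeasurable G -> qmeasurable H ->
  qmeasurable (fun x => G x - H x).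
Proof. by move=> [? ? ? ?] [? ? ? ?]; split; exact: measurable_funB. Qed.

Lemma measurable_qsqnorm G : qmeasurable G ->
  measurable_fun setT (fun x => qsqnorm (G x)).
Proof.
by move=> [? ? ? ?]; do 3?apply: measurable_funD; exact: measurable_funX.
Qed.

(** Limits for the distance [(G, H) |-> \int |G - H|^2] are unique almost
    everywhere. The functions [F n] need not have a finite norm, but their
    measurability matters: the integral of non-measurable nonnegative functions
    is not additive. *)
Lemma qL2_limit_unique (F : nat -> T -> quat R) G H :
  (forall n, qmeasurable (F n)) -> qmeasurable G -> qmeasurable H ->
  (fun n => \int[mu]_x (qsqnorm (G x - F n x))%:E)%E @ \oo --> 0%E ->
  (fun n => \int[mu]_x (qsqnorm (H x - F n x))%:E)%E @ \oo --> 0%E ->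
  {ae mu, forall x, G x = H x}.
Proof.
move=> mF mG mH GF HF.
have mE (K : T -> quat R) : qmeasurable K ->
    measurable_fun setT (fun x => (qsqnorm (K x))%:E).
  by move=> mK; apply/measurable_EFinP; exact: measurable_qsqnorm.
have ge0 (K : T -> quat R) x : setT x -> (0 <= (qsqnorm (K x))%:E)%E.
  by rewrite lee_fin qsqnorm_ge0.
have GH0 : (\int[mu]_x (qsqnorm (G x - H x))%:E = 0)%E.
  apply/eqP; rewrite eq_le; apply/andP; split; last first.
    by apply: integral_ge0 => x _; rewrite lee_fin qsqnorm_ge0.
  have lim0 : (fun n => 2%:E * (\int[mu]_x (qsqnorm (G x - F n x))%:E)
      + 2%:E * (\int[mu]_x (qsqnorm (H x - F n x))%:E))%E @ \oo --> 0%E.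
    rewrite -[X in _ --> X]add0e.
    by apply: cvgeD => //; rewrite -[X in _ --> X](mule0 2%:E); exact: cvgeZl.
  rewrite -(cvg_lim _ lim0)//; apply: lime_ge.
    by apply/cvg_ex; exists 0%E.
  apply: nearW => n.
  rewrite -!ge0_integralZl//; first last.
  - exact: (ge0 (fun x => G x - F n x)).
  - by apply: (mE (fun x => G x - F n x)); exact: qmeasurableB.
  - exact: (ge0 (fun x => H x - F n x)).
  - by apply: (mE (fun x => H x - F n x)); exact: qmeasurableB.
  rewrite -ge0_integralD//; first last.
  - apply: measurable_funeM; apply: (mE (fun x => H x - F n x)).
    exact: qmeasurableB.
  - by move=> x _; rewrite -EFinM lee_fin mulr_ge0// qsqnorm_ge0.
  - apply: measurable_funeM; apply: (mE (fun x => G x - F n x)).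
    exact: qmeasurableB.
  - by move=> x _; rewrite -EFinM lee_fin mulr_ge0// qsqnorm_ge0.
  apply: ge0_le_integral => //.
  - exact: (ge0 (fun x => G x - H x)).
  - by apply: (mE (fun x => G x - H x)); exact: qmeasurableB.
  - apply: emeasurable_funD; apply: measurable_funeM.
    + by apply: (mE (fun x => G x - F n x)); exact: qmeasurableB.
    + by apply: (mE (fun x => H x - F n x)); exact: qmeasurableB.
  - by move=> x _; rewrite -!EFinM -EFinD lee_fin qsqnormB_le.
have /(ae_eq_integral_abs mu measurableT) : measurable_fun setT
    (fun x => (qsqnorm (G x - H x))%:E).
  by apply: (mE (fun x => G x - H x)); exact: qmeasurableB.
case=> + _.
under eq_integral do rewrite gee0_abs ?lee_fin ?qsqnorm_ge0//.
move=> /(_ GH0); apply: filterS => x /(_ I) /= [/eqP].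
by rewrite qsqnorm_eq0 subr_eq0 => /eqP.
Qed.

End QuaternionValued.

(** * Fourier and Hilbert transforms on the plane *)

Section FourierTransform.
Context {R : realType}.
Implicit Types (f x : plane R) (g h : plane R -> R) (G H : plane R -> quat R).

Lemma L2_measurable g : g \in L2 -> measurable_fun setT g.
Proof. by move/sub_Lfun_mfun; rewrite inE. Qed.

Lemma L2_quat_qmeasurable G : L2_quat G -> qmeasurable G.
Proof. by case=> ? ? ? ?; split; exact: L2_measurable. Qed.

Lemma measurable_box n : measurable (box n : set (plane R)).
Proof. by apply: measurableX; exact: measurable_itv. Qed.

Lemma leb2_setX (A B : set (measurableTypeR R)) :
  measurable A -> measurable B ->
  leb2 (A `*` B) = (lebesgue_measure A * lebesgue_measure B)%E.
Proof. exact: product_measure1E. Qed.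

Lemma leb2_sigma_finite : sigma_finite setT (@leb2 R).
Proof.
exists box => [|n].
  apply/esym; rewrite -subTset => -[x y] _ /=.
  have [n xyn] : exists n : nat, Num.max `|x| `|y| <= n%:R.
    by exists (Num.truncn (Num.max `|x| `|y|)).+1; apply/ltW; exact: truncnS_gt.
  exists n => //; move: xyn; rewrite ge_max => /andP[xn yn].
  by split; rewrite /= in_itv/= -ler_norml.
split; first exact: measurable_box.
rewrite leb2_setX; [|exact: measurable_itv..].
rewrite lebesgue_measure_itv /=.
by case: ifP => _; rewrite ?mule0 ?ltry// -EFinB -EFinM ltry.
Qed.

(** The set function underlying [leb2], on which the structure of sigma-finite
    measure is declared. *)
Definition leb2_set : set (plane R) -> \bar R := leb2.
HB.instance Definition _ := Measure.on leb2_set.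
HB.instance Definition _ :=
  Measure_isSigmaFinite.Build _ _ _ leb2_set leb2_sigma_finite.

(** Components of the truncated transform; those along [i] and [k] vanish. *)
Lemma fourier_boxE n g f : fourier_box n g f =
  Quat (\int[leb2]_(x in box n) (g x * cos (- (2 * pi * dot f x)))) 0
       (\int[leb2]_(x in box n) (g x * sin (- (2 * pi * dot f x)))) 0.
Proof.
have int0 (u : plane R -> R) : u =1 (fun=> 0) ->
    \int[leb2]_(x in box n) u x = 0.
  move=> u0; rewrite /Rintegral integral0_eq// => x _.
  by rewrite u0.
rewrite /fourier_box /qintegral; congr Quat.
- apply: eq_Rintegral => x _ /=; ring.
- by apply: int0 => x /=; ring.
- apply: eq_Rintegral => x _ /=; ring.
- by apply: int0 => x /=; ring.
Qed.

Lemma measurable_dot :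
  measurable_fun setT (fun z : plane R * plane R => dot z.1 z.2).
Proof.
apply: measurable_funD; apply: measurable_funM;
  by apply: measurableT_comp => //; exact: measurableT_comp.
Qed.

Lemma measurable_fourier_kernel (u : R -> R) : continuous u ->
  measurable_fun setT
    (fun z : plane R * plane R => u (- (2 * pi * dot z.1 z.2))).
Proof.
move=> cu; apply: measurableT_comp; first exact: continuous_measurable_fun.
by apply: measurable_funN; apply: measurable_funM => //; exact: measurable_dot.
Qed.

Lemma measurable_fourier_box n g : measurable_fun setT g ->
  qmeasurable (fourier_box n g).
Proof.
move=> mg.
have mint (u : R -> R) : continuous u -> measurable_fun setT (fun f =>
    \int[leb2]_(x in box n) (g x * u (- (2 * pi * dot f x)))).
  move=> cu; apply: (@measurable_fun_Rintegral _ _ _ _ _ leb2_set _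
      (fun z => g z.2 * u (- (2 * pi * dot z.1 z.2)))).
    exact: measurable_box.
  apply: measurable_funM; first exact: measurableT_comp.
  exact: measurable_fourier_kernel.
rewrite (funext (fourier_boxE n g)).
split; [exact: (mint cos (@continuous_cos R))|exact: measurable_cst
  |exact: (mint sin (@continuous_sin R))|exact: measurable_cst].
Qed.

Lemma fourier_box_ae n g h : measurable_fun setT g -> measurable_fun setT h ->
  {ae leb2, forall x, g x = h x} -> fourier_box n g = fourier_box n h.
Proof.
move=> mg mh gh; apply/funext => f; rewrite !fourier_boxE.
have int_eq (u : R -> R) : continuous u ->
    \int[leb2]_(x in box n) (g x * u (- (2 * pi * dot f x))) =
    \int[leb2]_(x in box n) (h x * u (- (2 * pi * dot f x))).
  move=> cu; have mu : measurable_fun setT (fun x => u (- (2 * pi * dot f x))).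
    exact: (measurable_fun_pair2 f (measurable_fourier_kernel cu)).
  congr fine; apply: ae_eq_integral; first exact: measurable_box.
  - by apply/measurable_funTS/measurable_EFinP/measurable_funM.
  - by apply/measurable_funTS/measurable_EFinP/measurable_funM.
  - by apply: filterS gh => x -> _.
by congr Quat; [exact: (int_eq cos (@continuous_cos R))
  |exact: (int_eq sin (@continuous_sin R))].
Qed.

(** Holds for every real function: if the positive or the negative part has
    an infinite integral, both sides are [0], the value of [fine] at both
    infinities. *)
Lemma RintegralN (D : set (plane R)) g :
  \int[leb2]_(x in D) (- g x) = - \int[leb2]_(x in D) g x.
Proof.
rewrite /Rintegral; under eq_integral do rewrite EFinN.
rewrite integralE (integralE _ _ (fun x => (g x)%:E)) funeposN funenegN.
have : (0 <= \int[leb2]_(x in D) (fun x => (g x)%:E)^\+ x)%E.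
  by apply: integral_ge0 => x _; exact: funepos_ge0.
have : (0 <= \int[leb2]_(x in D) (fun x => (g x)%:E)^\- x)%E.
  by apply: integral_ge0 => x _; exact: funeneg_ge0.
case: (integral _ _ _) => [r| |]//; case: (integral _ _ _) => [s| |]// _ _ /=;
  by rewrite ?oppr0// opprB.
Qed.

Lemma fourier_boxN n g f : fourier_box n (\- g) f = - fourier_box n g f.
Proof.
rewrite !fourier_boxE; congr Quat; rewrite ?oppr0//= -RintegralN;
  by apply: eq_Rintegral => x _; rewrite mulNr.
Qed.

Lemma is_fourierN g G : is_fourier g G -> is_fourier (\- g) (fun f => - G f).
Proof.
move=> [[G1 G2 G3 G4] cG]; split; first by split; rewrite [_ \o _]/(\- _) rpredN.
apply: cvg_trans cG; apply: near_eq_cvg; apply: nearW => n.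
by apply: eq_integral => f _; rewrite fourier_boxN -opprD qsqnormN.
Qed.

(** The Fourier transform depends only on the almost everywhere class of the
    function, and is determined almost everywhere. *)
Lemma is_fourier_unique g h G H :
  measurable_fun setT g -> measurable_fun setT h ->
  {ae leb2, forall x, g x = h x} -> is_fourier g G -> is_fourier h H ->
  {ae leb2, forall f, G f = H f}.
Proof.
move=> mg mh gh [/L2_quat_qmeasurable mG cG] [/L2_quat_qmeasurable mH cH].
have mF n : qmeasurable (fourier_box n g) by exact: measurable_fourier_box.
apply: (qL2_limit_unique mF mG mH cG).
apply: cvg_trans cH; apply: near_eq_cvg; apply: nearW => n.
by rewrite (fourier_box_ae n mg mh gh).
Qed.

(** The total Hilbert transform is the Fourier multiplier
    [- sgn f1 * sgn f2]. *)
Lemma is_hilbertT_fourier g h G : measurable_fun setT g ->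
  is_hilbertT g h -> is_fourier g G ->
  exists2 K, is_fourier h K &
    {ae leb2, forall f, K f = qreal (- (Num.sg f.2 * Num.sg f.1)) * G f}.
Proof.
move=> mg [h1 [Lh1 [G1 gG1 h1G1]] [Lh [G2 h1G2 hG2]]] gG.
exists (fun f => - qj * qreal (Num.sg f.2) * G2 f) => //.
have mh1 := L2_measurable Lh1.
have eqG1 := is_fourier_unique mg mg (aeW _ (fun=> erefl)) gG1 gG.
have eqG2 := is_fourier_unique mh1 mh1 (aeW _ (fun=> erefl)) h1G2 h1G1.
by apply: filterS2 eqG1 eqG2 => f <- ->; exact: qj_multiplier2.
Qed.

(** The coordinate axes form a null set. *)
Lemma ae_coord_neq0 : {ae leb2, forall f, f.1 != 0 /\ f.2 != 0}.
Proof.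
pose Z : set (measurableTypeR R) := [set 0].
have mZ : measurable Z by exact: measurable_set1.
have Z0 : lebesgue_measure Z = 0%E by exact: lebesgue_measure_set1.
exists (Z `*` setT `|` setT `*` Z); split.
- by apply: measurableU; apply: measurableX.
- have lineV : leb2 (Z `*` setT) = 0%E by rewrite leb2_setX// Z0 mul0e.
  have lineH : leb2 (setT `*` Z) = 0%E by rewrite leb2_setX// Z0 mule0.
  by apply: null_set_setU => //; exact: measurableX.
- move=> f /= /not_andP[] /negP; rewrite negbK => /eqP f0; [left|right] => //.
Qed.

(** Two representatives [g] and [g'] of one class cannot have opposite total
    Hilbert transforms unless the Fourier transform of [g] vanishes. *)
Lemma is_hilbertT_opp_fourier_eq0 g g' h h' G :
  measurable_fun setT g -> measurable_fun setT g' ->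
  {ae leb2, forall x, g' x = g x} ->
  is_hilbertT g h -> is_hilbertT g' h' ->
  {ae leb2, forall x, h' x = - h x} ->
  is_fourier g G -> {ae leb2, forall f, G f = 0}.
Proof.
move=> mg mg' gg' gh gh' hh' gG.
have mh : measurable_fun setT h by case: gh => ? _ [/L2_measurable].
have mh' : measurable_fun setT h' by case: gh' => ? _ [/L2_measurable].
have [K hK KG] := is_hilbertT_fourier mg gh gG.
have [G' gG'] : exists G', is_fourier g' G' by case: gh' => ? [_ [G' ]]; exists G'.
have [K' hK' KG'] := is_hilbertT_fourier mg' gh' gG'.
have GG' := is_fourier_unique mg' mg gg' gG' gG.
have KK' := is_fourier_unique mh' (measurable_funN mh) hh' hK' (is_fourierN hK).
have axes := ae_coord_neq0.
near=> f.
have [f1 f2] : f.1 != 0 /\ f.2 != 0 by near: f.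
apply: (@qreal_eqN_eq0 _ (- (Num.sg f.2 * Num.sg f.1))).
  by rewrite oppr_eq0 mulf_eq0 !sgr_eq0 negb_or f1 f2.
have <- : K f = qreal (- (Num.sg f.2 * Num.sg f.1)) * G f by near: f.
have <- : K' f = - K f by near: f.
have -> : K' f = qreal (- (Num.sg f.2 * Num.sg f.1)) * G' f by near: f.
have -> : G' f = G f by near: f.
by near: f.
Unshelve. all: by end_near. Qed.

Lemma admissible_fourier_neq0 g : admissible g ->
  exists2 G, is_fourier g G & ~ {ae leb2, forall f, G f = 0}.
Proof.
case=> _ [G gG /andP[intG_gt0 _]]; exists G => // G0.
have [/L2_quat_qmeasurable mG _] := gG.
suff intG0 : (\int[leb2]_f (qsqnorm (G f) / (f.1 ^+ 2 + f.2 ^+ 2))%:E = 0)%E.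
  by move: intG_gt0; rewrite intG0 mule0 ltxx.
rewrite -(integral0 leb2 setT); apply: ae_eq_integral => //.
  apply/measurable_EFinP; apply: measurable_funM; first exact: measurable_qsqnorm.
  (* On nonnegative reals, inversion is the real power of exponent [-1]. *)
  rewrite (_ : (fun f => _) = (fun f => (f.1 ^+ 2 + f.2 ^+ 2) `^ (-1))).
    apply: (measurableT_comp (measurable_powR (-1))).
    by apply: measurable_funD; exact: measurable_funX.
  by apply/funext => f; rewrite powR_inv1// addr_ge0// sqr_ge0.
by apply: filterS G0 => f -> _; rewrite /qsqnorm /= expr0n/= !addr0 mul0r.
Qed.

End FourierTransform.

Theorem theorem2 (R : realType) (psi_ee : plane R -> R)
    (psi_L2 : psi_ee \in L2) (psi_adm : admissible psi_ee)
    (psi_sym : {ae leb2, forall x : plane R,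
       [/\ psi_ee (- x.1, x.2) = psi_ee x, psi_ee (x.1, - x.2) = psi_ee x,
           psi_ee (- x.1, - x.2) = psi_ee x & psi_ee (x.2, x.1) = psi_ee x]})
    (psi_pp : plane R -> quat R)
    (psi_ppE : hypercomplexing_wavelet psi_ee psi_pp) :
  ~ is_hypercomplex_signal psi_pp.
Proof.
case=> g gL2 [h1 [h2 [hT [_ _ ghT ppg]]]].
have [psi_oe [psi_eo [psi_oo [_ _ psiT pppsi]]]] := psi_ppE.
have [Psi psiF] := admissible_fourier_neq0 psi_adm; apply.
have comp : {ae leb2, forall x, g x = psi_ee x /\ hT x = - psi_oo x}.
  apply: filterS2 ppg pppsi => x -> [].
  rewrite !(mul0r, mul1r, subr0, addr0, add0r, sub0r, oppr0) => -> _ _ ->.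
  by [].
apply: (is_hilbertT_opp_fourier_eq0 (g' := g) (h' := hT) _ _ _ psiT ghT _ psiF).
- exact: L2_measurable.
- exact: L2_measurable.
- by apply: filterS comp => x [].
- by apply: filterS comp => x [].
Qed.
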